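(* The halved Farey graph $\breve F$ is infinitely edge-connected and is strongly immersed in every infinitely edge-connected graph. Moreover, up to immersion equivalence it is the unique such graph: if $H$ is an infinitely edge-connected graph that is strongly immersed in every infinitely edge-connected graph, then $H$ and $\breve F$ are each strongly immersed in the other.
   Context: All graphs are simple. A graph $G$ (with at least two vertices) is infinitely edge-connected if no two vertices of $G$ can be separated by deleting finitely many edges. A strong immersion of a graph $H$ in a graph $G$ is a map $\alpha$ with domain $V(H)\sqcup E(H)$ that embeds $V(H)$ injectively into $V(G)$ and sends every edge $uv\in E(H)$ to an $\alpha(u)$--$\alpha(v)$ path in $G$, such that these paths are pairwise edge-disjoint and no path $\alpha(e)$ has an internal vertex in $\alpha[V(H)]$. $H$ is (strongly) immersed in $G$ if such a map exists; two graphs are immersion-equivalent if each is immersed in the other. The halved Farey graph: $\breve F_0$ is a $K^2$ whose edge is coloured blue; $\breve F_{n+1}$ is obtained from $\breve F_n$ by adding, for every blue edge $e$ of $\breve F_n$, a new vertex $v_e$ joined by two blue edges exactly to the endvertices of $e$, and recolouring all edges of $\breve F_n$ black. The halved Farey graph is $\breve F=\bigcup_{n\in\mathbb N}\breve F_n$ (forgetting colours). *)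

(* Defs.v *)
From Stdlib Require List.
From mathcomp Require Import all_boot.
From mathcomp Require Import boolp classical_sets cardinality.

Set Implicit Arguments.
Unset Strict Implicit.
Unset Printing Implicit Defensive.

Local Open Scope classical_set_scope.

Record graph := Graph {
  vert :> Type;
  adj : vert -> vert -> Prop;
  adj_sym : forall x y, adj x y -> adj y x;
  adj_irrefl : forall x, ~ adj x x
}.

Definition edges (G : graph) : set (set G) :=
  [set e | exists x y : G, adj x y /\ e = [set x; y]].
Arguments edges G : clear implicits.

Lemma del_edges_sym (G : graph) (F : set (set G)) (x y : G) :
  adj x y /\ ~ F [set x; y] -> adj y x /\ ~ F [set y; x].
Proof. by rewrite [[set y; x]]setUC => -[/adj_sym]. Qed.

Lemma del_edges_irrefl (G : graph) (F : set (set G)) (x : G) :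
  ~ (adj x x /\ ~ F [set x; x]).
Proof. by case=> /adj_irrefl. Qed.

Definition del_edges (G : graph) (F : set (set G)) : graph :=
  Graph (@del_edges_sym G F) (@del_edges_irrefl G F).

(* Paths are given by the list of their vertices, ends included. *)
Definition path_edges (T : Type) (p : seq T) : set (set T) :=
  [set e | exists p1 x y p2, p = p1 ++ [:: x, y & p2] /\ e = [set x; y]].

Definition interior (T : Type) (p : seq T) : seq T :=
  if p is x :: s then behead (belast x s) else [::].

Definition is_path (G : graph) (x y : G) (p : seq G) : Prop :=
  [/\ exists2 s, p = x :: s & last x s = y,
      List.NoDup p
    & path_edges p `<=` edges G].

Definition infinitely_edge_connected (G : graph) : Prop :=
  (exists x y : G, x <> y) /\
  forall (x y : G) (F : set (set G)),
    x <> y -> F `<=` edges G -> finite_set F ->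
    exists p, is_path (G := del_edges F) x y p.

(* A path is an undirected object, so the list [ae [set u; v]] may run in
   either direction. The values of [ae] outside [edges H] are irrelevant. *)
Definition strong_immersion (H G : graph)
    (av : H -> G) (ae : set H -> seq G) : Prop :=
  [/\ injective av,
      forall u v, adj u v ->
        is_path (av u) (av v) (ae [set u; v]) \/
        is_path (av v) (av u) (ae [set u; v]),
      forall e f, edges H e -> edges H f -> e <> f ->
        path_edges (ae e) `&` path_edges (ae f) = set0
    & forall e z, edges H e -> List.In z (interior (ae e)) -> ~ range av z].

Definition strongly_immersed (H G : graph) : Prop :=
  exists (av : H -> G) (ae : set H -> seq G), strong_immersion av ae.

Definition immersion_equivalent (G H : graph) : Prop :=
  strongly_immersed G H /\ strongly_immersed H G.

(* [fmid u w] names the vertex v_e added for the blue edge e = uw. Every edge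
   is stored in exactly one of its two orientations ([blue_asym] below), so e
   gives rise to a single vertex; [fmid_fresh] shows that v_e is new. *)
Inductive fvert : Type :=
  | froot of bool
  | fmid of fvert & fvert.

Record coloured_graph := ColouredGraph {
  cvert : set fvert;
  black : fvert -> fvert -> Prop;
  blue : fvert -> fvert -> Prop
}.

Definition farey0 : coloured_graph := {|
  cvert := [set froot false; froot true];
  black := fun _ _ => False;
  blue := fun x y => x = froot false /\ y = froot true
|}.

Definition farey_step (F : coloured_graph) : coloured_graph := {|
  cvert := cvert F `|` [set x | exists u w, blue F u w /\ x = fmid u w];
  black := fun x y => black F x y \/ blue F x y;
  blue := fun x y => exists u w, blue F u w /\
    ((x = u /\ y = fmid u w) \/ (x = fmid u w /\ y = w))
|}.

Definition farey (n : nat) : coloured_graph := iter n farey_step farey0.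

Fixpoint fheight (x : fvert) : nat :=
  if x is fmid u w then (maxn (fheight u) (fheight w)).+1 else 0.

Lemma blue_height n x y :
  blue (farey n) x y -> maxn (fheight x) (fheight y) = n.
Proof.
elim: n x y => [|n IHn] x y /=; first by case=> -> ->.
case=> u [w [/IHn uw [] [-> ->]]] /=; rewrite uw.
  by apply/maxn_idPr; rewrite -uw leqW // leq_maxl.
by apply/maxn_idPl; rewrite -uw leqW // leq_maxr.
Qed.

Lemma cvert_height n x : cvert (farey n) x -> fheight x <= n.
Proof.
elim: n x => [|n IHn] x /=; first by case=> ->.
case=> [/IHn/leqW //|[u [w [/blue_height uw ->]]]] /=.
by rewrite uw.
Qed.

Lemma fmid_fresh n u w :
  blue (farey n) u w -> ~ cvert (farey n) (fmid u w).
Proof. by move=> /blue_height uw /cvert_height /=; rewrite uw ltnn. Qed.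

Lemma blue_irrefl n x : ~ blue (farey n) x x.
Proof.
case: n => [[-> //]|n] [u [w [/blue_height uw [] [-> /(congr1 fheight) /=]]]].
  by move=> e; have := leq_maxl (fheight u) (fheight w); rewrite {1}e ltnn.
by move=> e; have := leq_maxr (fheight u) (fheight w); rewrite -{1}e ltnn.
Qed.

Lemma black_irrefl n x : ~ black (farey n) x x.
Proof. by elim: n => [//|n IHn] /= [/IHn|/blue_irrefl]. Qed.

Lemma blue_asym n x y : blue (farey n) x y -> ~ blue (farey n) y x.
Proof.
case: n => [[-> _] [] //|n] [u [w [uw xy]]] [u' [w' [uw' yx]]].
have h := blue_height uw; have h' := blue_height uw'.
have lt1 := leq_maxl (fheight u') (fheight w').
have lt2 := leq_maxr (fheight u') (fheight w').
rewrite h' in lt1 lt2.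
case: xy => -[-> ->] in yx; case: yx => -[ex ey].
- by rewrite -ex /= h ltnn in lt1.
- by case: ex uw => _ ->; rewrite -ey; exact: blue_irrefl.
- by case: ey uw => -> _; rewrite -ex; exact: blue_irrefl.
- by rewrite -ey /= h ltnn in lt2.
Qed.

Definition farey_vert : Type := {x : fvert | exists n, cvert (farey n) x}.

Definition farey_adj (x y : farey_vert) : Prop :=
  exists n,
    (black (farey n) (sval x) (sval y) \/ blue (farey n) (sval x) (sval y)) \/
    (black (farey n) (sval y) (sval x) \/ blue (farey n) (sval y) (sval x)).

Lemma farey_adj_sym x y : farey_adj x y -> farey_adj y x.
Proof. by case=> n [?|?]; exists n; [right|left]. Qed.

Lemma farey_adj_irrefl x : ~ farey_adj x x.
Proof. by case=> n [] [/black_irrefl|/blue_irrefl]. Qed.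

Definition halved_farey : graph := Graph farey_adj_sym farey_adj_irrefl.

(* Main.v *)
From Stdlib Require List.
From Stdlib Require Import Relation_Operators.
From mathcomp Require Import all_boot.
From mathcomp Require Import boolp classical_sets cardinality.
(* Imported last: fingraph also exports a [froot]. *)
Require Import Defs.

(** Write x ~ y in G - S when no finite set of edges separates x from y in G - S.
    If m destroys this relation, then x ~ m in G - S - y (sim_cut).  An infinite
    clique of vertices that stay related after deleting any finitely many of the
    others hosts the halved Farey graph at once, so suppose that there is none.
    Then G - S has only finitely many ~-classes for every finite S.  Finitely many
    edges therefore separate all these classes, whence, as G is simple, related
    vertices x, y always have infinitely many m that are related to x in G - S - y
    and to y in G - S - x (sim_middle).  Moreover there is a finite S and a related
    pair a, b that is brittle: almost every such middle vertex m separates a from b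
    in G - S.  Inserting middle vertices between consecutive ones, starting from
    a, b, then yields the blue paths of the successive stages of the halved Farey
    graph: brittleness makes the inserted vertices linearly ordered separators of a
    and b, so that no insertion damages another blue edge.

    To find the brittle pair, take a maximal finite S for which some class C is
    related to every vertex x of S in G - (S - x).  By maximality each middle
    vertex of a pair in C that does not separate the pair cuts it off from some x
    in S.  If infinitely many do so for the same x, pass to a pair of these: the set
    of such x then shrinks. *)

Set Implicit Arguments.
Unset Strict Implicit.
Unset Printing Implicit Defensive.

Local Open Scope classical_set_scope.

Local Notation walk := (clos_refl_trans_1n _).

Section Walks.
Variables (T : Type) (R : T -> T -> Prop).
Implicit Types x y z m : T.

Lemma walk_trans x y z : walk R x y -> walk R y z -> walk R x z.
Proof. by elim=> [//|u v w uv _ IH /IH]; apply: rt1n_trans uv. Qed.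

Lemma walk1 x y : R x y -> walk R x y.
Proof. by move=> xy; apply: rt1n_trans xy (rt1n_refl _ _ _). Qed.

Lemma walk_sym x y : (forall u v, R u v -> R v u) -> walk R x y -> walk R y x.
Proof.
move=> Rsym; elim=> [u|u v w uv _ IH]; first exact: rt1n_refl.
by apply: walk_trans IH _; apply/walk1/Rsym.
Qed.

Lemma walk_mono (R' : T -> T -> Prop) x y :
  (forall u v, R u v -> R' u v) -> walk R x y -> walk R' x y.
Proof.
move=> RR'; elim=> [u|u v w uv _ IH]; first exact: rt1n_refl.
by apply: rt1n_trans (RR' _ _ uv) IH.
Qed.

End Walks.

Section WalkSplitting.
Variables (T : Type) (R : T -> T -> Prop).
Implicit Types x y z m : T.

Lemma walk_first x y m : walk R x y -> x <> m -> x <> y ->  m <> y ->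
  walk (fun u v => R u v /\ u <> m /\ v <> m) x y \/
  walk (fun u v => R u v /\ u <> y /\ v <> y) x m.
Proof.
elim=> [//|u v w uv vw IH] um uw mw.
case: (pselect (v = m)) => [vm|vm].
  by right; apply: walk1; subst; split.
case: (pselect (v = w)) => [vw'|vw'].
  by left; apply: walk1; subst; split=> //; split=> // /esym.
case: (IH vm vw' mw) => H; [left|right]; apply: rt1n_trans H => //.
Qed.

Lemma walk_leave x y : walk R x y -> x <> y ->
  exists v, [/\ R x v, v <> x & walk (fun u v => R u v /\ u <> x /\ v <> x) v y].
Proof.
move=> xy.
suff: forall z, walk R z y -> x <> y ->
    (exists v, [/\ R x v, v <> x & walk (fun u v => R u v /\ u <> x /\ v <> x) v y])
    \/ (z <> x /\ walk (fun u v => R u v /\ u <> x /\ v <> x) z y).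
  by move=> /(_ x xy) H /H[] // [].
move=> z; elim=> [u xu|u v w uv vw IH xw].
  by right; split; [exact: nesym|exact: rt1n_refl].
case: (IH xw) => [|[vx H]]; first by left.
case: (pselect (u = x)) => [ux|ux].
  by left; exists v; rewrite -ux in vx H *; split.
by right; split => //; apply: rt1n_trans H.
Qed.

End WalkSplitting.

(** * Separation by finitely many edges *)

Section Sim.
Variable G : graph.
Implicit Types (S X Z : set G) (F : set (set G)) (x y z m : G).

Definition link S F x y := [/\ ~ S x, ~ S y, adj x y & ~ F [set x; y]].

Lemma link_sym S F x y : link S F x y -> link S F y x.
Proof. by move=> [? ? /adj_sym ?]; rewrite setUC => ?; split. Qed.

Lemma link_mono S S' F F' x y : S' `<=` S -> F' `<=` F ->
  link S F x y -> link S' F' x y.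
Proof. by move=> SS FF [xS yS xy xyF]; split => // [/SS|/SS|/FF]. Qed.

Definition sim S x y :=
  [/\ ~ S x, ~ S y & forall F, finite_set F -> walk (link S F) x y].

Lemma sim_refl S x : ~ S x -> sim S x x.
Proof. by split=> // F _; apply: rt1n_refl. Qed.

Lemma sim_sym S x y : sim S x y -> sim S y x.
Proof.
move=> [Sx Sy xy]; split=> // F /xy; apply: walk_sym => u v; exact: link_sym.
Qed.

Lemma sim_trans S x y z : sim S x y -> sim S y z -> sim S x z.
Proof.
move=> [Sx Sy xy] [_ Sz yz]; split=> // F finF.
exact: walk_trans (xy F finF) (yz F finF).
Qed.

Lemma sim_mono S S' x y : S' `<=` S -> sim S x y -> sim S' x y.
Proof.
move=> SS [Sx Sy xy]; split=> [/SS|/SS|F /xy] //.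
by apply: walk_mono => u v; apply: link_mono.
Qed.

Lemma nsimP S x y : ~ S x -> ~ S y -> ~ sim S x y ->
  exists2 F, finite_set F & ~ walk (link S F) x y.
Proof.
move=> Sx Sy nxy; apply: contrapT => H; apply: nxy; split=> // F finF.
by apply: contrapT => nw; apply: H; exists F.
Qed.

Lemma sim_cut S x y m : sim S x y -> x <> m -> y <> m ->
  ~ sim (m |` S) x y -> sim (y |` S) x m.
Proof.
move=> [Sx Sy xy] xm ym nxy.
have xy' : x <> y.
  by move=> e; apply: nxy; rewrite -e; apply: sim_refl => -[].
have Sm : ~ S m.
  move=> Sm; apply: nxy; apply: (sim_mono (S := S)) => // z [->//|//].
have Smx : ~ (m |` S) x by case.
have Smy : ~ (m |` S) y by case.
have [F finF nw] := nsimP Smx Smy nxy.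
split; [by case|by case=> // /nesym|move=> F' finF'].
have finFF' : finite_set (F `|` F') by rewrite finite_setU.
have [w|w] := walk_first (xy _ finFF') xm xy' (nesym ym).
- case: nw; apply: walk_mono w => u v [[? ? ? FF] [? ?]].
  by split=> // [[]//|[]//|?]; apply: FF; left.
- apply: walk_mono w => u v [[? ? ? FF] [? ?]].
  by split=> // [[]//|[]//|?]; apply: FF; right.
Qed.

Lemma sim_test S (l : seq (G * G)) : exists2 F, finite_set F &
  forall x y F', List.In (x, y) l -> F `<=` F' -> ~ S x -> ~ S y ->
    walk (link S F') x y -> sim S x y.
Proof.
elim: l => [|[a b] l [F finF IH]]; first by exists set0.
case: (pselect (sim S a b \/ S a \/ S b)) => [ab|ab].
  exists F => // x y F' [[<- <-]|xyl] FF' Sx Sy w; last exact: IH xyl FF' Sx Sy w.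
  by case: ab => [//|[]].
have [| | |F1 finF1 nw] := @nsimP S a b; [tauto|tauto|tauto|].
exists (F `|` F1); first by rewrite finite_setU.
move=> x y F' [[<- <-]|xyl] FF' Sx Sy w.
  case: nw; apply: walk_mono w => u v; apply: link_mono => // e Fe.
  by apply: FF'; right.
by apply: IH xyl _ Sx Sy w => e Fe; apply: FF'; left.
Qed.

End Sim.

Section FiniteSets.
Variable T : Type.

Lemma finite_In (l : seq T) : finite_set [set x | List.In x l].
Proof.
elim: l => [|a l IH]; first exact: (sub_finite_set (B := set0)).
apply: (sub_finite_set (B := [set a] `|` [set x | List.In x l])).
  by move=> x [->|?]; [left|right].
by rewrite finite_setU.
Qed.

Lemma finite_listP (A : set T) :
  finite_set A -> exists l : seq T, A = [set x | List.In x l].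
Proof.
case/(@finite_seqP {classic T}) => s ->; exists s; rewrite predeqE => x /=.
elim: s => [|a s IH] //=; rewrite in_cons -IH; split.
  by case/orP => [/eqP ->|]; [left|right].
by case=> [->|->]; rewrite ?eqxx ?orbT.
Qed.

Lemma finite_set_ind (P : set T -> Prop) : P set0 ->
  (forall x A, finite_set A -> P A -> P (x |` A)) ->
  forall A, finite_set A -> P A.
Proof.
move=> P0 PU A /finite_listP [l ->]; elim: l => [|a l IH].
  by rewrite (_ : [set x | List.In x [::]] = set0) // predeqE.
rewrite (_ : [set x | List.In x (a :: l)] = a |` [set x | List.In x l]).
  by apply: PU IH; exact: finite_In.
by rewrite predeqE => x /=; split=> -[->|]; by [left|right].
Qed.

Lemma finite_sequence (P : set T -> T -> Prop) :
  (forall A, finite_set A -> exists x, P A x) ->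
  exists f : nat -> T, forall n, P (f @` `I_n) (f n).
Proof.
move=> HP; have [x0 _] := HP _ (finite_set0 _).
have [g gP] : {g & forall A, finite_set A -> P A (g A)}.
  apply: (choice (P := fun A x => finite_set A -> P A x)) => A.
  by case: (pselect (finite_set A)) => [/HP [x]|nA]; [exists x|exists x0].
pose h := fix h n := if n is m.+1 then g [set x | List.In x (h m)] :: h m else [::].
exists (fun n => g [set x | List.In x (h n)]) => n.
suff -> : (fun n => g [set x | List.In x (h n)]) @` `I_n = [set x | List.In x (h n)].
  exact/gP/finite_In.
rewrite predeqE => x; elim: n => [|n IH] /=; first by split=> // -[].
split=> [[k /=]|[<-|xn]].
- rewrite ltnS leq_eqVlt => /orP [/eqP ->|kn] kx; first by left.
  by right; apply/IH; exists k.
- by exists n => /=.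
- by have [k /= kn kx] := proj2 IH xn; exists k => //=; rewrite ltnS ltnW.
Qed.

End FiniteSets.

Section Classes.
Variable G : graph.
Implicit Types (S X Z : set G) (F : set (set G)) (x y z m : G).

Definition clique (f : nat -> G) := forall (A : set nat) i j,
  finite_set A -> ~ A i -> ~ A j -> sim (f @` A) (f i) (f j).

Hypothesis conn : forall x y, sim (@set0 G) x y.
Hypothesis no_clique : forall f, ~ clique f.

Lemma finite_classes S : finite_set S ->
  exists2 R, finite_set R & forall x, ~ S x -> exists2 r, R r & sim S x r.
Proof.
move: S; apply: finite_set_ind => [|z S finS [R finR RP]].
  case: (pselect (exists r : G, True)) => [[r _]|nr].
    by exists [set r] => // x _; exists r.
  by exists set0 => // x; case: nr; exists x.
apply: contrapT => noR.
have [f fP] : exists f : nat -> G, forall n, [/\ ~ (z |` S) (f n), sim S (f n) z &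
    forall a, (f @` `I_n) a -> ~ sim (z |` S) (f n) a].
  apply: (@finite_sequence G (fun A v => [/\ ~ (z |` S) v, sim S v z &
    forall a, A a -> ~ sim (z |` S) v a])) => A finA.
  apply: contrapT => nv; apply: noR; exists (R `|` A); first by rewrite finite_setU.
  move=> x zSx; apply: contrapT => nr; apply: nv; exists x; split=> //; last first.
    by move=> a Aa xa; apply: nr; exists a => //; right.
  have [r Rr xr] := RP x (fun Sx => zSx (or_intror Sx)).
  case: (pselect (r = z)) => [<- //|rz].
  have xz : x <> z by move=> xz; apply: zSx; left.
  apply: (sim_mono (S := r |` S)); first by move=> ? ?; right.
  by apply: sim_cut xr xz rz _ => xr; apply: nr; exists r => //; left.
have nf i j : i <> j -> ~ sim (z |` S) (f i) (f j).
  case: (ltngtP i j) => [ij|ji|//] _.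
    by move=> /sim_sym; case: (fP j) => _ _; apply; exists i.
  by case: (fP i) => _ _; apply; exists j.
(* No f k separates f i from z, as otherwise f i and f k would be related
   without z; hence z links the f i and they form a clique. *)
have star (A : set nat) i : finite_set A -> ~ A i -> sim (f @` A `|` S) (f i) z.
  move=> finA; move: A finA i; apply: finite_set_ind => [|k A _ IH] i.
    by move=> _; rewrite image_set0 set0U; case: (fP i).
  move=> kAi; have ik : i <> k by move=> ik; apply: kAi; left.
  have /IH iz : ~ A i by move=> Ai; apply: kAi; right.
  rewrite image_setU image_set1 -setUA.
  have [zi _ _] := fP i; have [zk _ _] := fP k.
  apply: contrapT => niz; apply: (nf i k ik).
  apply: (sim_mono (S := z |` (f @` A `|` S))).
    by move=> ? [->|?]; [left|right; right].
  apply: sim_cut iz _ _ niz => [fik|zfk]; last by apply: zk; left.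
  by apply: (nf i k ik); rewrite fik; apply: sim_refl.
apply: (no_clique (f := f)) => A i j finA Ai Aj.
apply: (sim_mono (S := f @` A `|` S)); first by move=> ? ?; left.
by apply: sim_trans (star _ _ finA Ai) _; apply/sim_sym/star.
Qed.

Lemma sim_middle S Z x y : finite_set S -> finite_set Z -> sim S x y -> x <> y ->
  exists m, [/\ ~ Z m, sim (y |` S) x m & sim (x |` S) y m].
Proof.
move=> finS finZ xy nxy; have [Sx Sy xyw] := xy.
pose X := x |` (y |` S).
have [|R finR RP] := @finite_classes X; first by rewrite !finite_setU.
have [l lE] := finite_listP finR.
have [F1 finF1 F1P] := sim_test X (List.list_prod l l).
have [F2 finF2 F2P] := sim_test (y |` S) (List.list_prod [:: x] l).
have [F3 finF3 F3P] := sim_test (x |` S) (List.list_prod [:: y] l).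
(* Avoiding F4 forces the first vertex after x out of Z; this is finite because
   G is simple. *)
pose F4 := (fun z => [set x; z]) @` (y |` Z).
pose F := (F1 `|` F2) `|` (F3 `|` F4).
have finF : finite_set F.
  by rewrite !finite_setU; do !split => //; apply: finite_image; rewrite finite_setU.
have [v [[_ Sv xv Fxv] vx vyw]] := walk_leave (xyw F finF) nxy.
have vy : v <> y by move=> e; apply: Fxv; right; right; exists y => //; [left|rewrite e].
have Zv : ~ Z v by move=> Zv; apply: Fxv; right; right; exists v => //; right.
have linksym : forall a b, link S F a b /\ a <> x /\ b <> x ->
   link S F b a /\ b <> x /\ a <> x.
  by move=> a b [/link_sym ? [? ?]].
have [w [[[_ Sw yw Fyw] [_ wx]] wy wvw]] := walk_leave (walk_sym linksym vyw) (nesym vy).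
have Xv : ~ X v by case=> [|[]].
have Xw : ~ X w by case=> [|[]].
have [r Rr vr] := RP v Xv; have [r' Rr' wr'] := RP w Xw.
have wvX : walk (link X F) w v.
  apply: walk_mono wvw => a b [[[Sa Sb ab Fab] [ax bx]] [ay yb]].
  by split=> // -[|[]].
have [_ Xr /(_ F finF) vrw] := vr; have [_ Xr' /(_ F finF) wrw'] := wr'.
have lr : List.In r l by move: Rr; rewrite lE.
have lr' : List.In r' l by move: Rr'; rewrite lE.
have rr' : sim X r r'.
  apply: (F1P r r' F) => //; first exact: List.in_prod.
    by move=> e ?; left; left.
  apply: walk_trans (walk_sym _ vrw) _ => [? ?|]; first exact: link_sym.
  apply: walk_trans (walk_sym _ wvX) wrw' => ? ?; exact: link_sym.
have vX : sim X r' v by apply: sim_trans (sim_sym rr') (sim_sym vr).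
exists v; split=> //.
- apply: (sim_trans (y := r)); last first.
    by apply: sim_mono (sim_sym vr) => ? ?; right.
  apply: (F2P x r F) => //.
  + by apply: List.in_prod => //; left.
  + by move=> e ?; left; right.
  + by case.
  + by move=> yr; apply: Xr; right.
  apply: (rt1n_trans _ _ _ v); first by split=> //; case.
  by apply: walk_mono vrw => ? ?; apply: link_mono => // ? ?; right.
- have yX : x |` S `<=` X by move=> ? [->|?]; [left|right; right].
  apply: (sim_trans (y := r')); last exact: sim_mono vX.
  apply: (F3P y r' F) => //.
  + by apply: List.in_prod => //; left.
  + by move=> e ?; right; left.
  + by case=> // /esym.
  + by move=> /yX.
  apply: (rt1n_trans _ _ _ w); first by split=> //; case=> // /esym.
  by apply: walk_mono wrw' => ? ?; apply: link_mono.
Qed.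

Hypothesis nontrivial : exists x y : G, x <> y.

(* The vertex c stands for its class: every x in X must be related to the class
   once the rest of X is deleted. *)
Definition full X c := ~ X c /\ forall x, X x -> sim (X `\ x) x c.

Lemma finite_nat_bound (A : set nat) : finite_set A -> exists n, A `<=` `I_n.
Proof.
move: A; apply: finite_set_ind => [|k A _ [n An]]; first by exists 0.
exists (maxn k.+1 n) => i [->|/An /= ?] /=; first exact: leq_maxl.
by rewrite leq_max orbC; apply/orP; left.
Qed.

Lemma maximal_full : exists X c, [/\ finite_set X, full X c &
  forall p d, ~ X p -> ~ full (p |` X) d].
Proof.
apply: contrapT => nomax.
have [f fP] : exists f : nat -> G, forall n,
    (exists c, full (f @` `I_n) c) ->
    ~ (f @` `I_n) (f n) /\ exists c, full (f n |` f @` `I_n) c.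
  apply: (@finite_sequence G (fun A v =>
    (exists c, full A c) -> ~ A v /\ exists c, full (v |` A) c)) => A finA.
  case: (pselect (exists c, full A c)) => [[c Ac]|nA]; last first.
    by have [x _] := nontrivial; exists x.
  apply: contrapT => nv; apply: nomax; exists A, c; split=> // p d Ap Apd.
  by apply: nv; exists p => _; split=> //; exists d.
have ffull n : exists c, full (f @` `I_n) c.
  elim: n => [|n /fP [_]].
    have [x _] := nontrivial; exists x; split=> [[]|y []] //.
  by rewrite IIS image_setU image_set1 setUC.
have finj i j : f i = f j -> i = j.
  case: (ltngtP i j) => // [ij e|ji e].
    by case: (fP _ (ffull j)) => + _; case; exists i.
  by case: (fP _ (ffull i)) => + _; case; exists j.
apply: (no_clique (f := f)) => A i j finA Ai Aj.
have [|n An] := @finite_nat_bound (i |` (j |` A)); first by rewrite !finite_setU.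
have [c [_ cP]] := ffull n.
have step k : (i |` (j |` A)) k -> ~ A k -> sim (f @` A) (f k) c.
  move=> kn Ak; apply: sim_mono (cP (f k) _); last by exists k => //; apply: An.
  move=> _ [l Al <-]; split; first by exists l => //; apply: An; right; right.
  by move=> /finj lk; apply: Ak; rewrite -lk.
by apply: sim_trans (step i _ Ai) (sim_sym (step j _ Aj)); [left|right; left].
Qed.

Lemma finite_exceptions (X : set G) (Q : G -> G -> Prop) : finite_set X ->
  exists2 Z, finite_set Z & forall x, X x ->
    (exists2 Z', finite_set Z' & forall q, ~ Z' q -> ~ Q x q) ->
    forall q, ~ Z q -> ~ Q x q.
Proof.
move: X; apply: finite_set_ind => [|y X _ [Z finZ ZP]]; first by exists set0.
case: (pselect (exists2 Z', finite_set Z' & forall q, ~ Z' q -> ~ Q y q)) => [[Z' finZ' Z'P]|nZ].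
  exists (Z `|` Z'); first by rewrite finite_setU.
  move=> x [->|Xx] H q Zq; first by apply: Z'P => ?; apply: Zq; right.
  by apply: ZP => // ?; apply: Zq; left.
by exists Z => // x [->|Xx] // H q Zq; exact: ZP.
Qed.

(** * Brittle pairs *)

Section Refine.
Variables (X : set G) (c : G).
Hypotheses (finX : finite_set X) (fullX : full X c).

Definition harmful a b x q := [/\ sim (b |` X) a q, sim (a |` X) b q,
  sim (q |` X) a b & ~ sim (q |` (X `\ x)) x a].

Definition infinitely_harmful a b x :=
  forall Z, finite_set Z -> exists2 q, ~ Z q & harmful a b x q.

Lemma harmful_refine a b x0 : sim X c a -> X x0 -> infinitely_harmful a b x0 ->
  exists q1 q2, [/\ q1 <> q2, sim X c q1, sim X q1 q2 & forall x, X x ->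
    infinitely_harmful q1 q2 x -> x <> x0 /\ infinitely_harmful a b x].
Proof.
move=> ca Xx0 inf0.
have [Z finZ ZP] := finite_exceptions (harmful a b) finX.
have Xsub x : X x -> X `<=` x |` (X `\ x).
  by move=> _ y Xy; case: (pselect (y = x)) => [|?]; [left|right].
have subX x : X `\ x `<=` X by move=> y [].
have subq q x : q |` (X `\ x) `<=` q |` X by move=> y [|[? _]]; [left|right].
have xa x : X x -> sim (X `\ x) x a.
  move=> Xx; apply: sim_trans (proj2 fullX x Xx) _; exact: sim_mono ca.
(* q1 and q2 both separate x0 from a; order them so that q2 separates q1 from a. *)
suff ordered q1 q2 : ~ Z q2 -> harmful a b x0 q1 -> harmful a b x0 q2 ->
    q1 <> q2 -> ~ sim (q2 |` (X `\ x0)) q1 a ->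
    exists q1 q2, [/\ q1 <> q2, sim X c q1, sim X q1 q2 & forall x, X x ->
    infinitely_harmful q1 q2 x -> x <> x0 /\ infinitely_harmful a b x].
  have [q1 Zq1 h1] := inf0 Z finZ.
  have [|q2 Zq2 h2] := inf0 (q1 |` Z); first by rewrite finite_setU.
  have q12 : q1 <> q2 by move=> e; apply: Zq2; left.
  have {}Zq2 : ~ Z q2 by move=> ?; apply: Zq2; right.
  have [aq1 _ _ n1] := h1; have [aq2 _ _ n2] := h2.
  case: (pselect (sim (q2 |` (X `\ x0)) x0 q1)) => xq1.
    apply: (ordered q1 q2) => // q1a; apply: n2; exact: sim_trans xq1 q1a.
  apply: (ordered q2 q1) => //; first exact: nesym.
  move=> q2a; apply: n1; apply: sim_trans q2a.
  apply: sim_cut xq1 => //.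
    apply: sim_trans (xa x0 Xx0) _; apply: sim_mono aq1 => y [? _]; by right.
  by move=> e; have [_ + _] := aq2; apply; right; rewrite -e.
move=> Zq2 h1 h2 q12 n12.
have [aq1 bq1 ab1 n1] := h1; have [aq2 bq2 ab2 n2] := h2.
have inX : forall S, X `<=` S -> forall y z, sim S y z -> sim X y z.
  by move=> S XS y z; exact: sim_mono.
have [_ q1bX _] := aq1; have [_ q2bX _] := aq2.
have q1a : q1 <> a by move=> e; have [_ + _] := bq1; apply; left.
have q2a : q2 <> a by move=> e; have [_ + _] := bq2; apply; left.
have {}aq1 : sim X a q1 by apply: inX aq1 => y; right.
have {}aq2 : sim X a q2 by apply: inX aq2 => y; right.
have n12X : ~ sim (q2 |` X) a q1.
  by move=> /sim_sym aq; apply: n12; apply: sim_mono aq.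
exists q1, q2; split=> //; [exact: sim_trans ca aq1|exact: sim_trans (sim_sym aq1) aq2|].
move=> x Xx infx.
have [|r ra [q1r q2r q12r nr]] := infx [set a]; first by [].
have ra' : a <> r by move=> e; apply: ra.
have [_ rX _] := q1r.
have rq2 : q2 <> r by move=> e; apply: rX; left.
have rq1 : q1 <> r by move=> e; have [_ + _] := q2r; apply; left.
have far : ~ sim (q2 |` X) a r.
  by move=> ar; apply: n12X; exact: sim_trans ar (sim_sym q1r).
have xr z : X z -> z <> r by move=> Xz e; apply: rX; right; rewrite -e.
split=> [xx0|].
  subst x.
  have x0r : sim (q1 |` (X `\ x0)) x0 r.
    apply: sim_cut nr => //; last exact: xr.
    by apply: sim_trans (xa x0 Xx) _; exact: sim_mono aq1.
  apply: n1; apply: (sim_trans (y := q2)).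
    by apply: sim_trans x0r (sim_sym _); apply: sim_mono q2r.
  apply: (sim_mono (S := q1 |` X)) => //; apply: sim_sym; apply: contrapT => naq2.
  by apply: n12X; apply: sim_cut naq2 => //; exact: nesym.
apply: contrapT => ninf.
have xaq2 : sim (q2 |` (X `\ x)) x a.
  apply: contrapT => nxa; have [] := ZP x Xx _ q2 Zq2.
    apply: contrapT => nZ; apply: ninf => Z' finZ'; apply: contrapT => nq.
    by apply: nZ; exists Z' => // q Zq hq; apply: nq; exists q.
  by have [? ? ? _] := h2; split.
have subx : q2 |` X `<=` x |` (q2 |` (X `\ x)).
  move=> y [->|/(Xsub x Xx) [->|?]]; [right; left|left|right; right] => //.
have A1 : sim (r |` (q2 |` (X `\ x))) x a.
  apply: sim_sym; apply: contrapT => nax; apply: far.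
  apply: (sim_mono subx); apply: sim_cut nax => //; [exact: sim_sym xaq2|exact: xr].
have A2 : sim (r |` X) a q2.
  apply: contrapT => naq; apply: far; exact: sim_cut naq.
apply: nr; apply: (sim_trans (y := q2)).
  apply: (sim_trans (y := a)); last exact: sim_mono A2.
  by apply: sim_mono A1 => y [|]; [left|right; right].
by apply: sim_sym; apply: sim_mono q12r.
Qed.

Lemma harmless_pair a b : a <> b -> sim X c a -> sim X a b ->
  exists a b, [/\ a <> b, sim X c a, sim X a b &
    forall x, X x -> ~ infinitely_harmful a b x].
Proof.
have [l lE] := finite_listP finX => ab ca sab.
have : forall x, X x -> infinitely_harmful a b x -> List.In x l.
  by move=> x; rewrite lE.
elim: l {lE} a b ab ca sab => [|x0 l IH] a b ab ca sab H.
  by exists a, b; split=> // x Xx /(H x Xx).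
case: (pselect (X x0 /\ infinitely_harmful a b x0)) => [[Xx0 inf0]|n0].
  have [q1 [q2 [q12 cq1 sq12 Hq]]] := harmful_refine ca Xx0 inf0.
  apply: (IH q1 q2) => // x Xx /(Hq x Xx) [xx0 /(H x Xx) [//|//]].
  by move=> /esym.
by apply: (IH a b) => // x Xx xab; case: (H x Xx xab) => // e; case: n0; rewrite e.
Qed.

End Refine.

Lemma brittle_pair : exists S Z a b, [/\ finite_set S, finite_set Z, a <> b, sim S a b &
  forall q, ~ Z q -> sim (b |` S) a q -> sim (a |` S) b q -> ~ sim (q |` S) a b].
Proof.
have [X [c [finX fullX maxX]]] := maximal_full.
have [d cd scd] : exists2 d, c <> d & sim X c d.
  case: (pselect (exists x, X x)) => [[x Xx]|X0].
    have [|||m [_ xm cm]] := @sim_middle (X `\ x) set0 x c _ _ (proj2 fullX x Xx).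
    - exact: finite_setD.
    - exact: finite_set0.
    - by move=> e; case: fullX => + _; apply; rewrite -e.
    exists m; first by move=> e; case: xm => _ + _; apply; left.
    apply: sim_mono cm => y Xy; case: (pselect (y = x)); [by left|by right].
  have -> : X = set0 by rewrite predeqE => y; split=> // Xy; case: X0; exists y.
  have [y [z yz]] := nontrivial.
  by case: (pselect (c = y)) => [cy|cy]; [exists z|exists y] => //; rewrite cy.
have cc : sim X c c by apply: sim_refl; case: fullX.
have [a [b [nab sca sab Hab]]] := harmless_pair finX fullX cd cc scd.
have [Z finZ ZP] := finite_exceptions (harmful X a b) finX.
exists X, Z, a, b; split=> // q Zq aq bq abq.
have Xq : ~ X q by have [_ + _] := aq; move=> H Xq; apply: H; right.
apply: (maxX q a Xq); split; first by case: abq.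
move=> x qXx; apply: contrapT => nxa.
case: (pselect (x = q)) => [xq|xq].
  subst x; apply: nxa; apply: sim_sym; apply: sim_mono aq => y [[->|]]; [|by right].
  by case.
have Xx : X x by case: qXx.
have [] := ZP x Xx _ q Zq.
  apply: contrapT => nZ; apply: (Hab x Xx) => Z' finZ'; apply: contrapT => nq.
  by apply: nZ; exists Z' => // p Zp hp; apply: nq; exists p.
split=> // xa; apply: nxa; apply: sim_mono xa => y [[->|?] ?]; [by left|by right].
Qed.

End Classes.

(** * Paths as lists *)

Section Consecutive.
Variable T : Type.
Implicit Types (p l : seq T) (a b c u v x y z m : T).

Definition consec p x y := exists p1 p2, p = p1 ++ [:: x, y & p2].

Lemma consec1 a x y : ~ consec [:: a] x y.
Proof. by case=> -[|? [|? ?]] [p2]. Qed.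

Lemma consec_cons a b p x y :
  consec [:: a, b & p] x y <-> (x = a /\ y = b) \/ consec (b :: p) x y.
Proof.
split=> [[[|c p1] [p2 []]]|[[-> ->]|[p1 [p2 ->]]]].
- by move=> -> -> _; left.
- by move=> _ e; right; exists p1, p2.
- by exists [::], p.
- by exists (a :: p1), p2.
Qed.

Lemma consec_catr l p x y : consec p x y -> consec (l ++ p) x y.
Proof. by case=> p1 [p2 ->]; exists (l ++ p1), p2; rewrite catA. Qed.

Lemma consec_catl l p x y : consec p x y -> consec (p ++ l) x y.
Proof. by case=> p1 [p2 ->]; exists p1, (p2 ++ l); rewrite -catA. Qed.

Lemma consec_cat l c p x y :
  consec (l ++ c :: p) x y <-> consec (l ++ [:: c]) x y \/ consec (c :: p) x y.
Proof.
split=> [|[H|/consec_catr //]]; last first.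
  by rewrite -cat1s catA; exact: consec_catl.
elim: l => [|a [|b l] IH]; first by right.
  by move/consec_cons => [[-> ->]|]; [left; exists [::], [::]|right].
by move/consec_cons => [[-> ->]|/IH [?|?]];
  [left; exists [::], (l ++ [:: c])|left; apply/consec_cons; right|right].
Qed.

Lemma In_cat x l p : List.In x (l ++ p) <-> List.In x l \/ List.In x p.
Proof. exact: List.in_app_iff. Qed.

Lemma In_split x p : List.In x p -> exists p1 p2, p = p1 ++ x :: p2.
Proof. exact: List.in_split. Qed.

Lemma consec_In p x y : consec p x y -> List.In x p /\ List.In y p.
Proof.
by case=> p1 [p2 ->]; split; apply/In_cat; right; [left|right; left].
Qed.

Lemma In_consec a b p x : List.In x [:: a, b & p] ->
  exists y, consec [:: a, b & p] x y \/ consec [:: a, b & p] y x.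
Proof.
elim: p a b => [|c p IH] a b.
  by case=> [<-|[<-|//]]; [exists b; left|exists a; right]; exists [::], [::].
case=> [<-|/IH [y [H|H]]].
- by exists b; left; exists [::], (c :: p).
- by exists y; left; apply/consec_cons; right.
- by exists y; right; apply/consec_cons; right.
Qed.

Lemma NoDup_insert l p m :
  List.NoDup (l ++ p) -> ~ List.In m (l ++ p) -> List.NoDup (l ++ m :: p).
Proof. by move=> lp mlp; apply/(List.NoDup_Add (List.Add_app m l p)). Qed.

Lemma NoDup_catP l p : List.NoDup (l ++ p) ->
  [/\ List.NoDup l, List.NoDup p & forall x, List.In x l -> ~ List.In x p].
Proof.
elim: l => [|a l IH] /= ; first by move=> ?; split=> //; exact: List.NoDup_nil.
move/List.NoDup_cons_iff => [alp /IH [Nl Np lp]]; split=> //.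
  by apply/List.NoDup_cons_iff; split=> // al; apply: alp; apply/In_cat; left.
by move=> x [<-|/lp //] ap; apply: alp; apply/In_cat; right.
Qed.

Lemma walk_path (R : T -> T -> Prop) x y : walk R x y ->
  exists s, [/\ last x s = y, List.NoDup (x :: s)
              & forall u v, consec (x :: s) u v -> R u v].
Proof.
elim=> [u|u v w uv _ [s [sw Ns Rs]]].
  exists [::]; split=> // [|? ? /consec1 //].
  by apply/List.NoDup_cons_iff; split=> //; exact: List.NoDup_nil.
case: (pselect (List.In u (v :: s))) => [/In_split [l1 [l2 e]]|us].
  exists l2; rewrite e in Ns Rs; split.
  - by have := congr1 (last u) e; rewrite last_cat /= sw.
  - by case: (NoDup_catP Ns).
  - by move=> a b ab; apply: Rs; exact: consec_catr.
exists (v :: s); split=> //; first by apply/List.NoDup_cons_iff.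
by move=> a b /consec_cons [[-> ->]|/Rs].
Qed.

End Consecutive.

Lemma set2_inj (T : Type) (a b c d : T) : [set a; b] = [set c; d] ->
  (a = c /\ b = d) \/ (a = d /\ b = c).
Proof.
move=> e.
have : [set c; d] a by rewrite -e; left.
have : [set c; d] b by rewrite -e; right.
have : [set a; b] c by rewrite e; left.
have : [set a; b] d by rewrite e; right.
by move=> /= [->|->] [->|->] [?|?] [?|?]; subst; by [left|right].
Qed.

Lemma path_edgesP (T : Type) (p : seq T) e :
  path_edges p e <-> exists x y, consec p x y /\ e = [set x; y].
Proof.
split=> [[p1 [x [y [p2 [pe ee]]]]]|[x [y [[p1 [p2 pe]] ee]]]].
  by exists x, y; split=> //; exists p1, p2.
by exists p1, x, y, p2.
Qed.

Lemma finite_path_edges (T : Type) (p : seq T) : finite_set (path_edges p).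
Proof.
elim: p => [|a [|b p] IH].
- by apply: (sub_finite_set (B := set0)) => // e [[|? ?] [? [? [? [//]]]]].
- by apply: (sub_finite_set (B := set0)) => // e [[|? [|? ?]] [? [? [? [//]]]]].
apply: (sub_finite_set (B := [set [set a; b]] `|` path_edges (b :: p))).
  move=> e /path_edgesP [x [y [/consec_cons [[-> ->]|xy] ->]]]; first by left.
  by right; apply/path_edgesP; exists x, y.
by rewrite finite_setU.
Qed.

Section Paths.
Variable G : graph.
Implicit Types (x y u v : G) (p : seq G).

Lemma walk_is_path (R : G -> G -> Prop) x y : (forall u v, R u v -> adj u v) ->
  walk R x y -> exists p, is_path x y p /\ forall u v, consec p u v -> R u v.
Proof.
move=> Radj w; have [s [sy Ns Rs]] := walk_path w; exists (x :: s); split=> //; split=> //.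
  by exists s.
by move=> e /path_edgesP [u [v [/Rs/Radj uv ->]]]; exists u, v.
Qed.

Lemma edges_adj x y : edges G [set x; y] -> adj x y.
Proof.
by case=> u [v [uv e]]; case: (set2_inj e) => -[-> ->] //; exact: adj_sym.
Qed.

Lemma interior_ends (T : Type) (x y z : T) (s : seq T) : last x s = y ->
  List.NoDup (x :: s) -> List.In z (interior (x :: s)) ->
  [/\ List.In z (x :: s), z <> x & z <> y].
Proof.
elim/last_ind: s => [//|s y' _]; rewrite last_rcons => -> /=.
rewrite belast_rcons /= -cats1 => N zs.
have [xs Ns] := proj1 (List.NoDup_cons_iff _ _) N.
split; first by right; apply/In_cat; left.
  by move=> zx; apply: xs; rewrite -zx; apply/In_cat; left.
by case: (NoDup_catP Ns) => _ _ /(_ z zs) nz zy; apply: nz; left.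
Qed.

Lemma is_path_walk (S : set G) F x y p : is_path x y p ->
  (forall u v, consec p u v -> link S F u v) -> walk (link S F) x y.
Proof.
case=> [[s ps sy] _ _] H; subst p; elim: s x sy H => [x /= <- _|a s IH x sy H].
  exact: rt1n_refl.
apply: (rt1n_trans _ _ _ a); first by apply: H; exists [::], s.
by apply: IH => // u v uv; apply: H; apply/consec_cons; right.
Qed.

End Paths.

Lemma infinitely_edge_connected_sim (G : graph) : infinitely_edge_connected G ->
  forall x y : G, sim set0 x y.
Proof.
move=> [_ conn] x y; split=> // F finF.
case: (pselect (x = y)) => [->|xy]; first exact: rt1n_refl.
have [|p pP] := conn x y (F `&` edges G) xy (@subIsetr _ _ _).
  exact: finite_setIl.
have [[s ps sy] Np pF] := pP.
have step u v : consec p u v -> link set0 F u v.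
  move=> uv; have [auv nF] : @adj (del_edges (F `&` edges G)) u v.
    by apply: edges_adj; apply/pF/path_edgesP; exists u, v.
  by split=> // Fuv; apply: nF; split=> //; exists u, v.
apply: (@is_path_walk G set0 F x y p) => //; split=> //; first by exists s.
by move=> e /path_edgesP [u [v [/step [_ _ uv _] ->]]]; exists u, v.
Qed.

(** * Blue edges of the halved Farey graph *)

Lemma blue_cvert n u w : blue (farey n) u w -> cvert (farey n) u /\ cvert (farey n) w.
Proof.
elim: n u w => [|n IH] u w /=; first by case=> -> ->; split; [left|right].
case=> u0 [w0 [b]]; have [cu cw] := IH _ _ b.
by case=> -[-> ->]; split; try (by left); right; exists u0, w0.
Qed.

Lemma farey_adj_blue (x y : farey_vert) : farey_adj x y ->
  exists n, blue (farey n) (sval x) (sval y) \/ blue (farey n) (sval y) (sval x).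
Proof.
have black_blue n u w : black (farey n) u w -> exists k, blue (farey k) u w.
  by elim: n => [//|n IH] /= [/IH|]; last by exists n.
case=> n [[/black_blue [k]|]|[/black_blue [k]|]] b.
- by exists k; left.
- by exists n; left.
- by exists k; right.
- by exists n; right.
Qed.

Lemma blue_connected n x : cvert (farey n) x ->
  walk (fun u w => blue (farey n) u w \/ blue (farey n) w u) (froot false) x.
Proof.
elim: n x => [|n IH] x /=.
  case=> ->; first exact: rt1n_refl.
  by apply: walk1; left.
set R := (fun u w => blue (farey n) u w \/ _) in IH.
set R' := (X in clos_refl_trans_1n _ X _ _).
have R'sym u w : R' u w -> R' w u by case; [right|left].
have RR' u w : blue (farey n) u w -> R' u (fmid u w) /\ R' (fmid u w) w.
  by move=> b; split; left; exists u, w; split=> //; [left|right].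
have lift u w : walk R u w -> walk R' u w.
  elim=> [v|v v' v'' b _]; first exact: rt1n_refl.
  apply: walk_trans; case: b => /RR' [b1 b2].
    exact: walk_trans (walk1 b1) (walk1 b2).
  exact: walk_trans (walk1 (R'sym _ _ b2)) (walk1 (R'sym _ _ b1)).
case=> [/IH/lift //|[u [w [b ->]]]]; have [cu _] := blue_cvert b.
by apply: walk_trans (lift _ _ (IH _ cu)) _; apply: walk1; have [] := RR' _ _ b.
Qed.

Lemma cvert_mono n k x : n <= k -> cvert (farey n) x -> cvert (farey k) x.
Proof.
move/subnKC <-; elim: (k - n) => [|d IH]; first by rewrite addn0.
by rewrite addnS => /IH; left.
Qed.

(* Deleted edges lie below some level N, and the blue edges of a single level beyond N
   already connect everything up to that level. *)
Lemma halved_farey_connected : infinitely_edge_connected halved_farey.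
Proof.
have root b : exists n, cvert (farey n) (froot b) by exists 0; case: b; [right|left].
split.
  by exists (exist _ (froot false) (root false) : farey_vert),
    (exist _ (froot true) (root true) : farey_vert) => -[].
move=> x y F xy FE finF.
have [N NP] : exists N, forall u w : halved_farey, F [set u; w] ->
    maxn (fheight (sval u)) (fheight (sval w)) <= N.
  move: F finF {FE}; apply: finite_set_ind => [|e F _ [N NP]]; first by exists 0.
  case: (pselect (exists a b : halved_farey, e = [set a; b])) => [[a [b ->]]|ne].
    exists (maxn (maxn (fheight (sval a)) (fheight (sval b))) N) => u w.
    case=> [e'|/NP H]; last by rewrite leq_max H orbT.
    by case: (set2_inj e') => -[-> ->]; rewrite leq_max ?leqnn // maxnC leqnn.
  by exists N => u w [e'|/NP //]; case: ne; exists u, w.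
have [nx cx] := svalP x; have [ny cy] := svalP y.
pose n := maxn (maxn nx ny) N.+1.
have {}cx : cvert (farey n) (sval x) by apply: cvert_mono cx; rewrite /n -maxnA leq_maxl.
have {}cy : cvert (farey n) (sval y).
  by apply: cvert_mono cy; rewrite /n -maxnA leq_max leq_max leqnn orbT.
pose B u w := blue (farey n) u w \/ blue (farey n) w u.
pose R := @adj (del_edges F).
have BR (u w : halved_farey) : B (sval u) (sval w) -> R u w.
  move=> b; split; first by exists n; case: b => b; [left|right]; right.
  have h : maxn (fheight (sval u)) (fheight (sval w)) = n.
    by case: b => /blue_height //; rewrite maxnC.
  by move=> /NP; rewrite h /n geq_max ltnn andbF.
have lift a b : walk B a b -> forall (u w : halved_farey), sval u = a -> sval w = b ->
    walk R u w.
  elim=> [c [u pu] [w pw] /= uc wc|c c' c'' cc' _ IH u w uc wc].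
    subst; rewrite (Prop_irrelevance pu pw); exact: rt1n_refl.
  have [n' cc] : exists n, cvert (farey n) c'.
    by exists n; case: cc' => /blue_cvert [].
  apply: (rt1n_trans _ _ _ (exist _ c' (ex_intro _ n' cc) : farey_vert)).
    by apply: BR; rewrite uc.
  exact: IH.
have Bsym u w : B u w -> B w u by case; [right|left].
have xyB : walk B (sval x) (sval y).
  by apply: walk_trans (walk_sym Bsym (blue_connected cx)) (blue_connected cy).
have [//|p [pxy _]] := @walk_is_path (del_edges F) R x y _ (lift _ _ xyB _ _ erefl erefl).
by exists p.
Qed.

Fixpoint subdivide (l : seq fvert) : seq fvert :=
  if l is x :: l' then
    if l' is y :: _ then [:: x, fmid x y & subdivide l'] else l
  else [::].

Definition blue_path n : seq fvert := iter n subdivide [:: froot false; froot true].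

Lemma subdivide_cons2 x y l :
  subdivide [:: x, y & l] = [:: x, fmid x y & subdivide (y :: l)].
Proof. by []. Qed.

Lemma subdivide_head x l : exists l', subdivide (x :: l) = x :: l'.
Proof. by case: l => [|y l]; eexists. Qed.

Lemma consec_subdivide l x y : consec (subdivide l) x y <->
  exists u w, consec l u w /\ ((x = u /\ y = fmid u w) \/ (x = fmid u w /\ y = w)).
Proof.
elim: l => [|a [|b l] IH].
- by split=> [[[|? ?] [? //]]|[u [w [[[|? ?] [? //]]]]]].
- by split=> [H|[u [w [H]]]]; case: (consec1 H).
rewrite subdivide_cons2; have [l' e] := subdivide_head b l.
rewrite e in IH *; split.
  move=> /consec_cons [[-> ->]|/consec_cons [[-> ->]|/IH [u [w [uw H]]]]].
  - by exists a, b; split; [apply/consec_cons; left|left].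
  - by exists a, b; split; [apply/consec_cons; left|right].
  - by exists u, w; split=> //; apply/consec_cons; right.
move=> [u [w [/consec_cons [[-> ->] [[-> ->]|[-> ->]]|uw H]]]].
- by apply/consec_cons; left.
- by apply/consec_cons; right; apply/consec_cons; left.
- by apply/consec_cons; right; apply/consec_cons; right; apply/IH; exists u, w.
Qed.

Lemma consec_blue_path n u w : consec (blue_path n) u w <-> blue (farey n) u w.
Proof.
elim: n u w => [|n IH] u w /=.
  split=> [H|[-> ->]]; last by apply/consec_cons; left.
  by case: (proj1 (consec_cons _ _ _ _ _) H) => [//|H1]; case: (consec1 H1).
rewrite consec_subdivide; split=> -[a [b [/IH ab H]]]; by exists a, b.
Qed.

Lemma In_subdivide l z : List.In z (subdivide l) <->
  List.In z l \/ exists u w, consec l u w /\ z = fmid u w.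
Proof.
elim: l => [|a [|b l] IH].
- by split=> [//|[//|[u [w [[[|? ?] [? //]]]]]]].
- by split=> [|[//|[u [w [H]]]]]; [left|case: (consec1 H)].
rewrite subdivide_cons2; split=> [[->|[<-|/IH [H|[u [w [uw zuw]]]]]]|].
- by left; left.
- by right; exists a, b; split=> //; apply/consec_cons; left.
- by left; right.
- by right; exists u, w; split=> //; apply/consec_cons; right.
case=> [[->|H]|[u [w [/consec_cons [[-> ->]|uw] zuw]]]].
- by left.
- by right; right; apply/IH; left.
- by right; left.
- by right; right; apply/IH; right; exists u, w.
Qed.

Lemma In_blue_path n z : List.In z (blue_path n) <-> cvert (farey n) z.
Proof.
elim: n z => [|n IH] z /=.
  by split=> [[<-|[<-|//]]|[->|->]]; [left|right|left|right; left].
rewrite In_subdivide; split=> -[/IH H|[u [w [/consec_blue_path uw ->]]]]; [left|right|left|right] => //; by exists u, w.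
Qed.

Lemma NoDup_blue_path n : List.NoDup (blue_path n).
Proof.
elim: n => [|n IH].
  apply/List.NoDup_cons_iff; split=> [[]//|].
  by apply/List.NoDup_cons_iff; split=> [|] //; exact: List.NoDup_nil.
have hle z : List.In z (blue_path n) -> fheight z <= n by move/In_blue_path/cvert_height.
have heq u w : consec (blue_path n) u w -> maxn (fheight u) (fheight w) = n.
  by move/consec_blue_path/blue_height.
rewrite [blue_path _]/=; move: (blue_path n) IH hle heq.
have fresh l u w : (forall z, List.In z l -> fheight z <= n) ->
    maxn (fheight u) (fheight w) = n -> ~ List.In (fmid u w) l.
  by move=> hle uw /hle /=; rewrite uw ltnn.
elim=> [//|a [//|b l] IH] Nl hle heq; rewrite subdivide_cons2.
have [al Nbl] := proj1 (List.NoDup_cons_iff _ _) Nl.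
have {}IH := IH Nbl (fun z zl => hle z (or_intror zl))
  (fun u w uw => heq u w (proj2 (consec_cons _ _ _ _ _) (or_intror uw))).
have hab : maxn (fheight a) (fheight b) = n.
  by apply: heq; apply/consec_cons; left.
apply/List.NoDup_cons_iff; split.
  case=> [e|/In_subdivide [//|[u [w [uw e]]]]].
    by apply: (fresh _ a b hle hab); left.
  apply: (fresh _ u w hle); last by left.
  by apply: heq; apply/consec_cons; right.
apply/List.NoDup_cons_iff; split=> //.
case/In_subdivide => [H|[u [w [uw [e _]]]]].
  by apply: (fresh _ a b hle hab); right.
by apply: al; rewrite e; have [] := consec_In uw.
Qed.

(** * Immersing the halved Farey graph stage by stage *)

Section Build.
Variables (G : graph) (admissible : seq G -> Prop).
Implicit Types (x y m v : G) (p : seq G) (u w a b : fvert).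

Definition others p x y : set G := [set v | [/\ List.In v p, v <> x & v <> y]].

Hypothesis adm_uniq : forall p, admissible p -> List.NoDup p.
Hypothesis adm_sim : forall p x y, admissible p -> consec p x y ->
  sim (others p x y) x y.
Hypothesis adm_insert : forall p1 x y p2 Z, admissible (p1 ++ [:: x, y & p2]) ->
  finite_set Z -> exists2 m, ~ Z m & admissible (p1 ++ [:: x, m, y & p2]).

Local Notation branch := (fvert * G)%type.
Local Notation route := ((fvert * fvert) * seq G)%type.
Implicit Types (L : seq branch) (D : seq route).

(* L is the current blue path together with the images of its vertices; D holds
   the paths assigned to the edges that have already been subdivided. *)
Definition stage L D :=
  [/\ admissible (map snd L),
      forall u w P, List.In ((u, w), P) D -> exists x y,
        [/\ List.In (u, x) L, List.In (w, y) L, is_path x y P &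
          forall v, List.In v (map snd L) -> List.In v P -> v = x \/ v = y]
    & forall k P k' P', List.In (k, P) D -> List.In (k', P') D -> k <> k' ->
        path_edges P `&` path_edges P' = set0].

Lemma stage_insert L1 u x w y L2 D : stage (L1 ++ [:: (u, x), (w, y) & L2]) D ->
  exists m P, stage (L1 ++ [:: (u, x), (fmid u w, m), (w, y) & L2]) (((u, w), P) :: D).
Proof.
set L := L1 ++ _ => -[adm Droute Ddisj].
have Lxy : map snd L = map snd L1 ++ [:: x, y & map snd L2] by rewrite map_cat.
have cxy : consec (map snd L) x y by exists (map snd L1), (map snd L2).
have Nxy : x <> y.
  move=> xy; move: (adm_uniq adm); rewrite Lxy => /NoDup_catP [_ N _].
  by move: (proj1 (List.NoDup_cons_iff _ _) N) => -[xs _]; apply: xs; left.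
pose F : set (set G) := [set e | exists k P, List.In (k, P) D /\ path_edges P e].
have finF : finite_set F.
  rewrite {}/F; elim: D {Droute Ddisj} => [|[k P] D IH].
    by apply: (sub_finite_set (B := set0)) => // e [? [? [[]]]].
  apply: (sub_finite_set (B := path_edges P `|` [set e | exists k P,
      List.In (k, P) D /\ path_edges P e])).
    by move=> e [k' [P' [[[_ <-]|H] He]]]; [left|right; exists k', P'].
  by rewrite finite_setU; split=> //; exact: finite_path_edges.
have [_ _ wxy] := adm_sim adm cxy.
have linkadj : forall v v', link (others (map snd L) x y) F v v' -> adj v v' by move=> v v' [].
have [P [Pxy Plink]] := walk_is_path linkadj (wxy F finF).
pose Z : set G := [set v | List.In v P] `|`
  [set v | exists k P', List.In (k, P') D /\ List.In v P'].
have finZ : finite_set Z.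
  rewrite finite_setU; split; first exact: finite_In.
  elim: D {Droute Ddisj F finF wxy linkadj Plink Z} => [|[k P'] D IH].
    by apply: (sub_finite_set (B := set0)) => // v [? [? [[]]]].
  apply: (sub_finite_set (B := [set v | List.In v P'] `|` [set v | exists k P',
      List.In (k, P') D /\ List.In v P'])).
    by move=> v [k' [P1 [[[_ <-]|H] He]]]; [left|right; exists k', P1].
  by rewrite finite_setU; split=> //; exact: finite_In.
move: (adm); rewrite Lxy => /adm_insert /(_ finZ) [m Zm admm].
exists m, P; set L' := L1 ++ _.
have L'm : map snd L' = map snd L1 ++ [:: x, m, y & map snd L2] by rewrite map_cat.
have sub t : List.In t L -> List.In t L'.
  move=> /In_cat [tL|[tL|tL]]; apply/In_cat; [by left|by right; left|].
  by right; right; right.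
have sub' v : List.In v (map snd L') -> v = m \/ List.In v (map snd L).
  rewrite Lxy L'm => /In_cat [H|[H|[H|H]]]; last 1 first.
  - by right; apply/In_cat; right; right.
  - by right; apply/In_cat; left.
  - by right; apply/In_cat; right; left.
  - by left.
split; first by rewrite L'm.
- move=> u' w' P' [[<- <- <-]|DP'].
    exists x, y; split=> //.
    + by apply/In_cat; right; left.
    + by apply/In_cat; right; right; right; left.
    move=> v /sub' [-> mP|vL vP]; first by case: Zm; left.
    apply: contrapT => nxy.
    have nv : others (map snd L) x y v by split=> // ?; apply: nxy; [left|right].
    have [[s Ps sy] _ _] := Pxy; case: s Ps sy => [_ /Nxy //|c s Ps _].
    rewrite Ps in vP Plink; have [v' []] := In_consec vP => /Plink [] //.
  have [x' [y' [ux wy pxy vxy]]] := Droute _ _ _ DP'.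
  exists x', y'; split=> //; [exact: sub|exact: sub|].
  by move=> v /sub' [-> mP|]; [case: Zm; right; exists (u', w'), P'|exact: vxy].
have disjP k P' : List.In (k, P') D -> path_edges P `&` path_edges P' = set0.
  move=> DP'; rewrite predeqE => e; split=> // -[/path_edgesP [v [v' [vv' ->]]] vP'].
  by have [_ _ _] := Plink _ _ vv'; apply; exists k, P'.
move=> k1 P1 k2 P2 [[<- <-]|D1] [[<- <-]|D2] // k12; first exact: disjP D2.
- by rewrite setIC; exact: disjP D1.
- exact: Ddisj D1 D2 k12.
Qed.

Lemma stage_subdivide L2 L1 u x D : stage (L1 ++ (u, x) :: L2) D ->
  exists L' D', [/\ stage (L1 ++ L') D',
    map fst L' = subdivide (u :: map fst L2),
    forall t, List.In t ((u, x) :: L2) -> List.In t L',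
    forall t, List.In t D -> List.In t D' &
    forall a b, consec (u :: map fst L2) a b -> exists P, List.In ((a, b), P) D'].
Proof.
elim: L2 L1 u x D => [|[w y] L2 IH] L1 u x D st.
  by exists [:: (u, x)], D; split=> // a b H; case: (consec1 H).
have [m [P]] := stage_insert st.
have -> : L1 ++ [:: (u, x), (fmid u w, m), (w, y) & L2] =
  (L1 ++ [:: (u, x); (fmid u w, m)]) ++ (w, y) :: L2 by rewrite -catA.
move=> /IH [L' [D' [st' fstL' LL' DD' DL']]].
exists [:: (u, x), (fmid u w, m) & L'], D'; split.
- by rewrite -catA in st'.
- by rewrite /= fstL'.
- by move=> t [->|tL]; [left|right; right; apply: LL'].
- by move=> t tD; apply: DD'; right.
move=> a b ab; case: (proj1 (consec_cons _ _ _ _ _) ab) => [[-> ->]|/DL' //].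
by exists P; apply: DD'; left.
Qed.

Hypothesis adm_start : exists x y, admissible [:: x; y].

Lemma stages : exists (L : nat -> seq branch) (D : nat -> seq route),
  [/\ forall n, stage (L n) (D n), forall n, map fst (L n) = blue_path n,
      forall n k t, n <= k -> List.In t (L n) -> List.In t (L k),
      forall n k t, n <= k -> List.In t (D n) -> List.In t (D k) &
      forall n u w, consec (blue_path n) u w -> exists P, List.In ((u, w), P) (D n.+1)].
Proof.
pose next (s t : seq branch * seq route) := stage s.1 s.2 -> [/\ stage t.1 t.2,
    map fst t.1 = subdivide (map fst s.1),
    forall k, List.In k s.1 -> List.In k t.1,
    forall k, List.In k s.2 -> List.In k t.2 &
    forall a b, consec (map fst s.1) a b -> exists P, List.In ((a, b), P) t.2].
have [f fP] : {f & forall s, next s (f s)}.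
  apply: choice => -[[|[u x] L] D].
    exists ([::], D) => st; split=> // a b.
    by case=> -[|? ?] [? //].
  case: (pselect (stage ((u, x) :: L) D)) => st; last by exists ([::], [::]) => /st.
  by have [L' [D' H]] := @stage_subdivide L [::] u x D st; exists (L', D').
have [x [y xy]] := adm_start.
pose s n := iter n f ([:: (froot false, x); (froot true, y)], [::]).
have st n : stage (s n).1 (s n).2.
  by elim: n => [|n IH]; [split|case: (fP _ IH)].
have mono (A : Type) (g : nat -> seq A) n k t : n <= k ->
    (forall n t, List.In t (g n) -> List.In t (g n.+1)) ->
    List.In t (g n) -> List.In t (g k).
  move=> /subnKC <- H; elim: (k - n) => [|d IH] tn; first by rewrite addn0.
  by rewrite addnS; apply: H; apply: IH.
have fstE n : map fst (s n).1 = blue_path n.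
  by elim: n => [//|n IH]; have [_ /= -> _ _ _] := fP _ (st n); rewrite IH.
exists (fun n => (s n).1), (fun n => (s n).2); split=> //.
- move=> n k t nk; apply: (mono _ (fun n => (s n).1)) => // j t'.
  by have [_ _ H _ _] := fP _ (st j); exact: H.
- move=> n k t nk; apply: (mono _ (fun n => (s n).2)) => // j t'.
  by have [_ _ _ H _] := fP _ (st j); exact: H.
- by move=> n u w; rewrite -fstE => uw; have [_ _ _ _ /(_ u w uw)] := fP _ (st n).
Qed.

Lemma NoDup_map_inj (A B : Type) (f : A -> B) (l : seq A) (s t : A) :
  List.NoDup (map f l) -> List.In s l -> List.In t l -> f s = f t -> s = t.
Proof.
elim: l => [//|a l IH] /= N; have [al Nl] := proj1 (List.NoDup_cons_iff _ _) N.
move=> [<-|sl] [<-|tl] // e; last exact: IH.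
- by case: al; rewrite e; apply: List.in_map.
- by case: al; rewrite -e; apply: List.in_map.
Qed.

Lemma admissible_immersion : strongly_immersed halved_farey G.
Proof.
have [L [D [st fstL Lmono Dmono Dall]]] := stages.
have [av avP] : {av : halved_farey -> G & forall t, exists n, List.In (sval t, av t) (L n)}.
  apply: (choice (P := fun (t : halved_farey) v => exists n, List.In (sval t, v) (L n))).
  move=> [a [n /= an]]; move/In_blue_path: an; rewrite -fstL.
  by move=> /List.in_map_iff [[a' v] [/= <- av]]; exists v, n.
have route_uniq n a v v' : List.In (a, v) (L n) -> List.In (a, v') (L n) -> v = v'.
  move=> v1 v2; have : (a, v) = (a, v'); last by case.
  by apply: (NoDup_map_inj (f := fst) (l := L n)) => //; rewrite fstL; exact: NoDup_blue_path.
have branch_uniq n a a' v : List.In (a, v) (L n) -> List.In (a', v) (L n) -> a = a'.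
  move=> v1 v2; have : (a, v) = (a', v); last by case.
  by apply: (NoDup_map_inj (f := snd) (l := L n)) => //; case: (st n) => /adm_uniq.
pose carries (e : set halved_farey) P := edges halved_farey e ->
  exists n (t t' : halved_farey), List.In ((sval t, sval t'), P) (D n) /\ e = [set t; t'].
have [ae aeP] : {ae & forall e, carries e (ae e)}.
  apply: choice => e; case: (pselect (edges halved_farey e)) => [|ne]; last first.
    by exists [::] => /ne.
  case=> t [t' [/farey_adj_blue [n [|]] /consec_blue_path /Dall [P DP] ->]]; exists P => _.
    by exists n.+1, t, t'.
  by exists n.+1, t', t; split=> //; rewrite setUC.
have endpoints n (t t' : halved_farey) P : List.In ((sval t, sval t'), P) (D n) ->
    is_path (av t) (av t') P /\ forall t'' : halved_farey, List.In (av t'') P ->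
      av t'' = av t \/ av t'' = av t'.
  have [k tk] := avP t; have [k' tk'] := avP t'; move=> DP.
  have path_at N : n <= N -> k <= N -> k' <= N -> is_path (av t) (av t') P /\
      forall v, List.In v (map snd (L N)) -> List.In v P -> v = av t \/ v = av t'.
    move=> nN kN k'N; have [_ H _] := st N.
    have [x [y [tx ty pxy vxy]]] := H _ _ _ (Dmono _ _ _ nN DP).
    by rewrite (route_uniq N _ _ _ (Lmono _ _ _ kN tk) tx)
      (route_uniq N _ _ _ (Lmono _ _ _ k'N tk') ty).
  split.
    have [] // := path_at (maxn n (maxn k k')).
    - by rewrite leq_maxl.
    - by rewrite !leq_max leqnn /= !orbT.
    - by rewrite !leq_max leqnn /= !orbT.
  move=> t''; have [k'' tk''] := avP t''.
  have [|||_] := path_at (maxn k'' (maxn n (maxn k k'))).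
  - by rewrite !leq_max leqnn /= !orbT.
  - by rewrite !leq_max leqnn /= !orbT.
  - by rewrite !leq_max leqnn /= !orbT.
  apply; apply/List.in_map_iff; exists (sval t'', av t''); split=> //.
  by apply: Lmono tk''; rewrite leq_maxl.
exists av, ae; split.
- move=> t t' tt'; have [k tk] := avP t; have [k' tk'] := avP t'.
  have tt : sval t = sval t'.
    apply: (branch_uniq (maxn k k') _ _ (av t)).
      by apply: Lmono tk; rewrite leq_maxl.
    by rewrite tt'; apply: Lmono tk'; rewrite leq_maxr.
  case: t t' tt {tt' tk tk'} => [a pa] [b pb] /= ab; subst b.
  by rewrite (Prop_irrelevance pa pb).
- move=> t t' tt'; have [|n [s [s' [Ds e]]]] := aeP [set t; t']; first by exists t, t'.
  have [ps _] := endpoints _ _ _ _ Ds.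
  by case: (set2_inj e) => -[ts ts']; rewrite -ts -ts' in ps; [left|right].
- move=> e f He Hf ef; have [n [s [s' [Ds ee]]]] := aeP e He.
  have [k [r [r' [Dr fe]]]] := aeP f Hf.
  have [_ _ disj] := st (maxn n k).
  apply: (disj (sval s, sval s') _ (sval r, sval r')).
  + by apply: Dmono Ds; rewrite leq_maxl.
  + by apply: Dmono Dr; rewrite leq_maxr.
  case=> sr sr'; apply: ef; rewrite ee fe.
  case: s s' r r' sr sr' {ee fe Ds Dr} => [a pa] [b pb] [c pc] [d pd] /= ac bd; subst c d.
  by rewrite (Prop_irrelevance pa pc) (Prop_irrelevance pb pd).
- move=> e z He; have [n [s [s' [Ds _]]]] := aeP e He.
  have [[[q Pq sq] Nq _] Pends] := endpoints _ _ _ _ Ds.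
  rewrite Pq in Nq Pends *; move=> zint [t _ tz].
  have [zP zs zs'] := interior_ends sq Nq zint.
  by case: (Pends t); rewrite tz.
Qed.

End Build.

(** * Cliques and brittle pairs host the halved Farey graph *)

Section Chains.
Variable G : graph.
Implicit Types (S Z : set G) (x y m v : G) (p l : seq G).

Lemma sim_chain S l x y : (forall u v, consec l u v -> sim S u v) ->
  (forall v, List.In v l -> ~ S v) -> List.In x l -> List.In y l -> sim S x y.
Proof.
move=> lS nS.
have head c k : (forall u v, consec (c :: k) u v -> sim S u v) -> ~ S c ->
    forall z, List.In z (c :: k) -> sim S c z.
  elim: k c => [|d k IH] c ck Sc z [<-|]; [exact: sim_refl|by []|exact: sim_refl|].
  have cd : sim S c d by apply: ck; exists [::], k.
  have [_ Sd _] := cd; move=> zk; apply: sim_trans cd _; apply: IH zk => //.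
  by move=> u v uv; apply: ck; apply/consec_cons; right.
case: l lS nS => [//|c k] lS nS xl yl.
have Sc : ~ S c by apply: nS; left.
exact: sim_trans (sim_sym (head c k lS Sc x xl)) (head c k lS Sc y yl).
Qed.

Lemma clique_immersion (f : nat -> G) : clique f -> strongly_immersed halved_farey G.
Proof.
move=> clf.
have finj i j : f i = f j -> i = j.
  move=> e; apply: contrapT => ij.
  have [nij _ _] := clf [set j] i i (finite_set1 j) ij ij.
  by apply: nij; rewrite image_set1.
have avoid Z : finite_set Z -> exists n0, forall n, n0 <= n -> ~ Z (f n).
  move: Z; apply: finite_set_ind => [|x Z _ [n0 Zn]]; first by exists 0 => n _ [].
  case: (pselect (exists k, f k = x)) => [[k kx]|nx].
    exists (maxn n0 k.+1) => n; rewrite geq_max => /andP [n0n kn] [e|]; last exact: Zn.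
    by move: kn; rewrite (finj n k) ?ltnn // e.
  by exists n0 => n n0n [e|]; [apply: nx; exists n|exact: Zn].
apply: (@admissible_immersion G (fun p => List.NoDup p /\
  exists I : seq nat, forall v, List.In v p -> exists2 i, List.In i I & v = f i)).
- by move=> p [].
- move=> p x y [Np [I pI]] xy; have [xp yp] := consec_In xy.
  have [i _ xi] := pI x xp; have [j _ yj] := pI y yp; rewrite xi yj.
  pose A := [set k | List.In k I /\ (k <> i /\ k <> j)].
  apply: (sim_mono (S := f @` A)); last first.
    apply: clf; [|by case=> _ []|by case=> _ []].
    by apply: (sub_finite_set _ (finite_In I)) => k [].
  move=> v [/pI [k kI ->] ki kj]; exists k => //; split=> //.
  by split=> e; [apply: ki|apply: kj]; rewrite e.
- move=> p1 x y p2 Z [Np [I pI]] finZ.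
  have [|n0 Zn] := avoid (Z `|` [set v | List.In v (p1 ++ [:: x, y & p2])]).
    by rewrite finite_setU; split=> //; exact: finite_In.
  have np : ~ (Z `|` [set v | List.In v (p1 ++ [:: x, y & p2])]) (f n0) by apply: Zn.
  exists (f n0); first by move=> ?; apply: np; left.
  split.
    have -> : p1 ++ [:: x, f n0, y & p2] = (p1 ++ [:: x]) ++ f n0 :: y :: p2.
      by rewrite -catA.
    have e : (p1 ++ [:: x]) ++ y :: p2 = p1 ++ [:: x, y & p2] by rewrite -catA.
    by apply: NoDup_insert; rewrite e // => ?; apply: np; right.
  exists (n0 :: I) => v /In_cat H.
  have [->|/pI [i iI ->]] : v = f n0 \/ List.In v (p1 ++ [:: x, y & p2]).
  + case: H => [H|[H|[H|H]]]; last 1 first.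
    * by right; apply/In_cat; right; right.
    * by right; apply/In_cat; left.
    * by right; apply/In_cat; right; left.
    * by left.
  + by exists n0 => //; left.
  + by exists i => //; right.
- exists (f 0), (f 1); split; last first.
    by exists [:: 0; 1] => v [<-|[<-|//]]; [exists 0; [left|]|exists 1; [right; left|]].
  apply/List.NoDup_cons_iff; split=> [[/finj|]|] //.
  by apply/List.NoDup_cons_iff; split=> [|] //; exact: List.NoDup_nil.
Qed.

Lemma In_last x l : List.In (last x l) (x :: l).
Proof. by elim: l x => [|c l IH] x; [left|right; exact: IH]. Qed.

Lemma consec_rcons l x u v : consec (l ++ [:: x]) u v -> List.In u l.
Proof.
elim: l => [H|c [|d l] IH H]; first by case: (consec1 H).
  by case: (proj1 (consec_cons _ _ _ _ _) H) => [[-> _]|/IH]; [left|].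
by case: (proj1 (consec_cons _ _ _ _ _) H) => [[-> _]|/IH]; [left|right].
Qed.

Lemma consec_behead l x u v : consec (x :: l) u v -> List.In v l.
Proof.
elim: l x => [|c l IH] x H; first by case: (consec1 H).
by case: (proj1 (consec_cons _ _ _ _ _) H) => [[_ ->]|/IH]; [left|right].
Qed.

Section Brittle.
Variables (S Z : set G) (a b : G).
Hypotheses (conn : forall x y, sim (@set0 G) x y) (no_clique : forall f, ~ @clique G f).
Hypotheses (finS : finite_set S) (finZ : finite_set Z) (ab : a <> b) (sab : sim S a b).
Hypothesis brittle : forall q, ~ Z q ->
  sim (b |` S) a q -> sim (a |` S) b q -> ~ sim (q |` S) a b.

Definition brittle_path p := [/\ List.NoDup p,
  exists2 s, p = a :: s & last a s = b,
  forall x y, consec p x y -> sim (others p x y `|` S) x y &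
  forall t, List.In t p -> t <> a -> t <> b -> ~ sim (t |` S) a b].

Lemma brittle_path_insert p1 x y p2 Z' : brittle_path (p1 ++ [:: x, y & p2]) ->
  finite_set Z' -> exists2 m, ~ Z' m & brittle_path (p1 ++ [:: x, m, y & p2]).
Proof.
set p := p1 ++ _ => -[Np [s ps sb] psim pcut] finZ'.
have pE : p = (p1 ++ [:: x]) ++ y :: p2 by rewrite -catA.
have [Nl Nr lr] : [/\ List.NoDup (p1 ++ [:: x]), List.NoDup (y :: p2) &
    forall v, List.In v (p1 ++ [:: x]) -> ~ List.In v (y :: p2)].
  by apply: NoDup_catP; rewrite -pE.
have [_ _ p1x] := NoDup_catP Nl.
have [yp2 _] := proj1 (List.NoDup_cons_iff _ _) Nr.
have cxy : consec p x y by exists p1, p2.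
have [xp yp] := consec_In cxy.
have xl : List.In x (p1 ++ [:: x]) by apply/In_cat; right; left.
have ap1 : p1 <> [::] -> List.In a p1.
  by move: ps; rewrite /p; case: (p1) => [//|c l] [-> _] _; left.
have al : List.In a (p1 ++ [:: x]).
  by move: ps; rewrite /p; case: (p1) => [[-> _]|c l [-> _]]; left.
have lastE : b = last y p2.
  by move: (congr1 (last a) ps); rewrite /p last_cat /= sb.
have bp2 : p2 <> [::] -> List.In b p2.
  by rewrite lastE; case: (p2) => [//|c l] _; exact: In_last.
have br : List.In b (y :: p2) by rewrite lastE; exact: In_last.
have xy : x <> y by move=> e; apply: (lr x xl); rewrite e; left.
have pS v : List.In v p -> ~ S v.
  rewrite ps; case: s ps sb => [_ /= /ab //|c l ps _] vs.
  have [v' []] := In_consec vs; rewrite -ps.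
    by move=> /psim [H _ _] Sv; apply: H; right.
  by move=> /psim [_ H _] Sv; apply: H; right.
have seg t l u v : (forall c d, consec l c d -> consec p c d) ->
    (forall c, List.In c l -> List.In c p) -> List.In t p -> ~ List.In t l ->
    List.In u l -> List.In v l -> sim (t |` S) u v.
  move=> lp lp' tp tl; apply: sim_chain => [c d cd|c cl [ct|]]; last 1 first.
  - exact/pS/lp'.
  - have [cl dl] := consec_In cd; apply: sim_mono (psim c d (lp c d cd)).
    move=> z [->|Sz]; last by right.
    by left; split=> // e; apply: tl; rewrite e.
  - by apply: tl; rewrite -ct.
have segl t u v : List.In t p -> ~ List.In t (p1 ++ [:: x]) ->
    List.In u (p1 ++ [:: x]) -> List.In v (p1 ++ [:: x]) -> sim (t |` S) u v.
  apply: seg => c; rewrite pE; last by move=> ?; apply/In_cat; left.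
  by move=> d; exact: consec_catl.
have segr t u v : List.In t p -> ~ List.In t (y :: p2) ->
    List.In u (y :: p2) -> List.In v (y :: p2) -> sim (t |` S) u v.
  apply: seg => c; rewrite pE; last by move=> ?; apply/In_cat; right.
  by move=> d; exact: consec_catr.
pose A := others p x y `|` S.
have finA : finite_set A.
  rewrite finite_setU; split=> //; apply: (sub_finite_set _ (finite_In p)).
  by move=> v [].
have [|m [Zm xm ym]] := sim_middle conn no_clique finA (Z := Z' `|` Z) _ (psim _ _ cxy) xy.
  by rewrite finite_setU.
have [_ yAm _] := xm; have [_ xAm _] := ym.
have mp : ~ List.In m p.
  move=> mp; apply: yAm; case: (pselect (m = y)) => [->|my]; first by left.
  by right; left; split=> // mx; apply: xAm; left.
have mv v : List.In v p -> v <> m by move=> vp e; apply: mp; rewrite -e.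
have inA t : List.In t p -> t <> x -> t <> y -> A t by move=> *; left.
have xmS t : List.In t p -> t <> x -> sim (t |` S) x m.
  move=> tp tx; apply: sim_mono xm => v [->|Sv]; last by right; right.
  by case: (pselect (t = y)) => [->|?]; [left|right; exact: inA].
have ymS t : List.In t p -> t <> y -> sim (t |` S) y m.
  move=> tp ty; apply: sim_mono ym => v [->|Sv]; last by right; right.
  by case: (pselect (t = x)) => [->|?]; [left|right; exact: inA].
have ap : List.In a p by rewrite ps; left.
have bp : List.In b p by rewrite pE; apply/In_cat; right.
have bl : ~ List.In b (p1 ++ [:: x]) by move=> /lr.
have ar : ~ List.In a (y :: p2) by apply: lr.
have cutm : ~ sim (m |` S) a b.
  apply: brittle.
  - by move=> ?; apply: Zm; right.
  - apply: sim_trans (segl b a x bp bl al xl) (xmS b bp _).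
    by move=> e; apply: bl; rewrite e.
  - apply: sim_trans (segr a b y ap ar br _) (ymS a ap _); first by left.
    by move=> e; apply: ar; rewrite e; left.
exists m; first by move=> ?; apply: Zm; left.
set p' := p1 ++ _.
have In_p' v : List.In v p' -> v = m \/ List.In v p.
  move=> /In_cat [H|[H|[H|H]]]; last 1 first.
  - by right; apply/In_cat; right; right.
  - by right; apply/In_cat; left.
  - by right; apply/In_cat; right; left.
  - by left.
have sub' u v : others p' u v `|` S `<=` m |` (others p u v `|` S).
  by move=> t [[/In_p' [->|tp] tu tv]|St]; [left|right; left|right; right].
split.
- have -> : p' = (p1 ++ [:: x]) ++ m :: y :: p2 by rewrite /p' -catA.
  by apply: NoDup_insert; rewrite -pE.
- exists (behead p').
    by move: ps; rewrite /p /p'; case: (p1) => [[-> _]|c l [-> _]].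
  by rewrite /p'; case: (p1) => [|c l] /=; rewrite ?last_cat /= -lastE.
- move=> u v /(consec_cat p1 x) [uv|uv].
  + have up1 := consec_rcons uv.
    have ux : u <> x by move=> e; apply: (p1x u up1); left.
    have ap1' : List.In a p1 by apply: ap1 => e; rewrite e in up1.
    have uvp : consec p u v by rewrite pE; exact: consec_catl.
    have [up vp] := consec_In uvp.
    apply: (sim_mono (@sub' u v)); apply: contrapT => nuv.
    have um : sim (x |` S) u m.
      apply: sim_mono (sim_cut (psim u v uvp) (mv u up) (mv v vp) nuv).
      move=> t [->|]; last by right; right.
      by case: (pselect (x = v)) => [|xv]; [left|right; left; split=> //; exact: nesym].
    apply: (pcut x xp).
    * by move=> e; apply: (p1x a ap1'); left.
    * by move=> e; apply: bl; rewrite -e.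
    apply: (sim_trans (y := u)).
      apply: (seg x p1) => //.
      * by move=> c d cd; exact: consec_catl.
      * by move=> c ?; apply/In_cat; left.
      * by move=> xp1; apply: (p1x x xp1); left.
    apply: sim_trans um (sim_trans (sim_sym (ymS x xp xy)) _).
    by apply: segr => //; [exact: lr|left].
  + case: (proj1 (consec_cons _ _ _ _ _) uv) => [[-> ->]|{}uv].
      apply: sim_mono xm => t [[/In_p' [->|tp] tx tm]|]; [by []| |by right; right].
      by case: (pselect (t = y)) => [|?]; [left|right; exact: inA].
    case: (proj1 (consec_cons _ _ _ _ _) uv) => [[-> ->]|{}uv].
      apply: sim_sym; apply: sim_mono ym => t [[/In_p' [->|tp] tm ty]|]; [by []| |by right; right].
      by case: (pselect (t = x)) => [|?]; [left|right; exact: inA].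
    have vp2 := consec_behead uv.
    have vy : v <> y by move=> e; apply: yp2; rewrite -e.
    have bp2' : List.In b p2 by apply: bp2 => e; rewrite e in vp2.
    have uvp : consec p u v by rewrite pE; exact: consec_catr.
    have [up vp] := consec_In uvp.
    apply: sim_sym; apply: (sim_mono (@sub' u v)); apply: contrapT => nuv.
    have vm : sim (y |` S) v m.
      apply: sim_mono (sim_cut (sim_sym (psim u v uvp)) (mv v vp) (mv u up) nuv).
      move=> t [->|]; last by right; right.
      by case: (pselect (y = u)) => [|yu]; [left|right; left; split=> //; exact: nesym].
    apply: (pcut y yp).
    * by move=> e; apply: ar; rewrite e; left.
    * by move=> e; apply: yp2; rewrite e.
    apply: (sim_trans (y := x)).
      by apply: segl => // yl; apply: (lr y yl); left.
    apply: sim_trans (xmS y yp (nesym xy)) (sim_trans (sim_sym vm) _).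
    apply: (seg y p2) => //.
    * move=> c d cd; rewrite pE; apply: consec_catr.
      by rewrite -cat1s; exact: consec_catr.
    * by move=> c ?; rewrite pE; apply/In_cat; right; right.
- by move=> t /In_p' [-> //|tp] ta tb; exact: pcut.
Qed.

Lemma brittle_immersion : strongly_immersed halved_farey G.
Proof.
apply: (@admissible_immersion G brittle_path).
- by move=> p [].
- by move=> p x y [_ _ psim _] /psim; apply: sim_mono => ? ?; left.
- by move=> p1 x y p2 Z'; exact: brittle_path_insert.
exists a, b; split.
- apply/List.NoDup_cons_iff; split=> [[/esym/ab|]|] //.
  by apply/List.NoDup_cons_iff; split=> [|] //; exact: List.NoDup_nil.
- by exists [:: b].
- move=> x y xy; case: (proj1 (consec_cons _ _ _ _ _) xy) => [[-> ->]|H].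
    by apply: sim_mono sab => t [[[->|[->|//]]]|].
  by case: (consec1 H).
- by move=> t [->|[->|]].
Qed.

End Brittle.
End Chains.

Theorem theorem1 :
  infinitely_edge_connected halved_farey /\
  (forall G : graph, infinitely_edge_connected G ->
     strongly_immersed halved_farey G) /\
  (forall H : graph, infinitely_edge_connected H ->
     (forall G : graph, infinitely_edge_connected G -> strongly_immersed H G) ->
     immersion_equivalent H halved_farey).
Proof.
have immersed G : infinitely_edge_connected G -> strongly_immersed halved_farey G.
  move=> Gconn; have conn := infinitely_edge_connected_sim Gconn.
  case: (pselect (exists f, @clique G f)) => [[f /clique_immersion //]|nc].
  have no_clique f : ~ @clique G f by move=> cf; apply: nc; exists f.
  have [S [Z [a [b [finS finZ ab sab brittle]]]]] := brittle_pair conn no_clique (proj1 Gconn).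
  exact: brittle_immersion brittle.
split; first exact: halved_farey_connected.
split=> // H Hconn Himm; split; first exact/Himm/halved_farey_connected.
exact: immersed.
Qed.
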